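(* The enveloping operad $\mathrm{Env}(\mathrm{Bulle})$ of the $2$-coloured operad $\mathrm{Bulle}$ is isomorphic to the operad $\mathrm{CNCB}$ of bicoloured noncrossing configurations. That is, $\mathrm{Bulle}$ is a $2$-bubble decomposition of $\mathrm{CNCB}$.
   Context: BNCs: for $n\ge2$, a bicoloured noncrossing configuration (BNC) of size $n$ is a regular polygon with vertices $1,\dots,n+1$ clockwise, together with disjoint sets of blue arcs and red arcs among the arcs $(i,j)$, $1\le i<j\le n+1$. The arcs $(i,i+1)$ are the edges ($i$th edge), $(1,n+1)$ is the base, and the other arcs are diagonals. The conditions are: coloured (blue or red) arcs are pairwise noncrossing ($(i,j),(k,l)$ cross iff $i<k<j<l$ or $k<i<l<j$), and red arcs are diagonals. There is one BNC of size $1$: a blue segment. The operad $\mathrm{CNCB}$ has BNCs as elements (arity = size) and unit the size-$1$ BNC. Its composition $\mathfrak C\circ_i\mathfrak D$ ($\mathfrak C$ of size $n$, $\mathfrak D$ of size $m$) glues the base of $\mathfrak D$ onto the $i$th edge of $\mathfrak C$. Arcs $(a,b)$ of $\mathfrak C$ go to $(\sigma(a),\sigma(b))$ with $\sigma(v)=v$ for $v\le i$ and $v+m-1$ otherwise, and arcs $(a,b)$ of $\mathfrak D$ go to $(a+i-1,b+i-1)$, all keeping their colours. The exception is the arc $(i,i+m)$, which is red if the $i$th edge of $\mathfrak C$ and the base of $\mathfrak D$ are both uncoloured, blue if both are blue, and uncoloured otherwise. $\mathrm{Bulle}$: a bubble is a BNC of size $\ge2$ without coloured diagonals. Its output colour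 is $1$ if its base is blue and $2$ otherwise, and its $i$th input colour is $1$ if its $i$th edge is uncoloured and $2$ if blue. $\mathrm{Bulle}$ is the $2$-coloured operad of bubbles plus two units $\mathbf 1_1,\mathbf 1_2$, with composition that of $\mathrm{CNCB}$, defined exactly when the output colour of the second argument equals the $i$th input colour of the first. Equivalently, a bubble is encoded by $(c;d_1\cdots d_n)$ (output colour, word of input colours), and composition is substitution of the word of the second bubble at position $i$. Enveloping operad: for a coloured operad $\mathcal C$ whose arity-$1$ elements are exactly its units, with $\mathcal C^+$ its elements of arity $\ge2$, $\mathrm{Env}(\mathcal C)$ is the quotient of the free uncoloured operad on $\mathcal C^+$ (colours forgotten) by the smallest operadic congruence with $\mathfrak c(x)\circ_i\mathfrak c(y)\equiv\mathfrak c(x\circ_i y)$ whenever $x\circ_i y$ is defined in $\mathcal C$. Here $\mathfrak c(x)$ is the corolla labelled $x$. *)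

(* Defs.v *)
From mathcomp Require Import all_boot.

Set Implicit Arguments.
Unset Strict Implicit.
Unset Printing Implicit Defensive.

(* A BNC of size n has vertices 1..n+1; each arc (i,j), 1 <= i < j <= n+1,   *)
(* is uncoloured, blue or red.  We store the colouring as a finite function  *)
(* on pairs of 'I_(n+2) (vertex 0 is unused); well-formedness (below)         *)
(* requires every pair that is not an arc to be uncoloured, so that the      *)
(* representation is canonical and Leibniz equality is equality of BNCs.     *)

Inductive colour := Unc | Blue | Red.

Record bnc := BNC {
  bsize : nat;
  bcol : {ffun 'I_bsize.+2 * 'I_bsize.+2 -> colour}
}.

Definition col (b : bnc) (i j : nat) : colour :=
  match (insub i : option 'I_(bsize b).+2), (insub j : option 'I_(bsize b).+2) with
  | Some a, Some c => bcol b (a, c)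
  | _, _ => Unc
  end.

Definition mk_bnc (n : nat) (f : nat -> nat -> colour) : bnc :=
  @BNC n [ffun p : 'I_n.+2 * 'I_n.+2 => f (val p.1) (val p.2)].

Definition is_arc (n i j : nat) : Prop := 1 <= i /\ i < j /\ j <= n.+1.

Definition is_diagonal (n i j : nat) : Prop :=
  is_arc n i j /\ j <> i.+1 /\ ~ (i = 1 /\ j = n.+1).

Definition crossing (i j k l : nat) : Prop :=
  (i < k /\ k < j /\ j < l) \/ (k < i /\ i < l /\ l < j).

Definition is_bnc (b : bnc) : Prop :=
  let n := bsize b in
  [/\ 1 <= n,
      (forall i j, col b i j <> Unc -> is_arc n i j),
      (forall i j, col b i j = Red -> is_diagonal n i j),
      (forall i j k l, col b i j <> Unc -> col b k l <> Unc -> ~ crossing i j k l)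
    & (n = 1 -> col b 1 2 = Blue)].

Definition bnc_unit : bnc := mk_bnc 1 (fun a c => if (a == 1) && (c == 2) then Blue else Unc).

(* Composition C o_i D of CNCB.  For an arc (a,b) of the result, either it is
   the exceptional arc (i,i+m), or it is the image of an arc of D under
   v |-> v+i-1 (when i <= a, b <= i+m), or the image of an arc of C under
   sigma (sigma v = v for v <= i, v+m-1 otherwise); unsig inverts sigma. *)
Definition bnc_comp (C : bnc) (i : nat) (D : bnc) : bnc :=
  let n := bsize C in
  let m := bsize D in
  let unsig v := if v <= i then v else v - m.-1 in
  mk_bnc (n + m).-1 (fun a b =>
    if (a == i) && (b == i + m) then
      match col C i i.+1, col D 1 m.+1 with
      | Unc, Unc => Red
      | Blue, Blue => Blue
      | _, _ => Unc
      end
    else if (i <= a) && (b <= i + m) then col D (a - i).+1 (b - i).+1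
    else if ((a <= i) || (i + m <= a)) && ((b <= i) || (i + m <= b)) then
      col C (unsig a) (unsig b)
    else Unc).

Definition is_bubble (b : bnc) : Prop :=
  [/\ is_bnc b, 2 <= bsize b &
      forall i j, is_diagonal (bsize b) i j -> col b i j = Unc].

Definition out_colour (b : bnc) : nat :=
  match col b 1 (bsize b).+1 with Blue => 1 | _ => 2 end.

Definition in_colour (b : bnc) (i : nat) : nat :=
  match col b i i.+1 with Unc => 1 | _ => 2 end.

(* Free (nonsymmetric, uncoloured) operad on the bubbles: planar trees whose *)
(* internal nodes are labelled by bubbles with as many children as arity.    *)

Inductive tree := Leaf | Node of bnc & seq tree.

Fixpoint arity (t : tree) : nat :=
  match t with
  | Leaf => 1
  | Node _ ts => (fix go (ts : seq tree) := match ts with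
                   | [::] => 0 | t1 :: ts' => arity t1 + go ts' end) ts
  end.

Fixpoint wf_tree (t : tree) : Prop :=
  match t with
  | Leaf => True
  | Node x ts => [/\ is_bubble x, size ts = bsize x &
                   (fix go (ts : seq tree) : Prop := match ts with
                    | [::] => True | t1 :: ts' => wf_tree t1 /\ go ts' end) ts]
  end.

(* partial composition t o_i s : graft s on the i-th leaf (1-indexed,
   left to right) of t *)
Fixpoint graft (t : tree) (i : nat) (s : tree) : tree :=
  match t with
  | Leaf => if i == 1 then s else Leaf
  | Node x ts => Node x ((fix go (ts : seq tree) (i : nat) := match ts with
                   | [::] => [::]
                   | t1 :: ts' => if (1 <= i) && (i <= arity t1) then graft t1 i s :: ts'
                                  else t1 :: go ts' (i - arity t1) end) ts i)
  end.

Definition corolla (x : bnc) : tree := Node x (nseq (bsize x) Leaf).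

(* The smallest operadic congruence on (well-formed trees of) the free operad
   with  c(x) o_i c(y) == c(x o_i y)  whenever x o_i y is defined in Bulle. *)
Inductive env_cong : tree -> tree -> Prop :=
  | ec_base x i y : is_bubble x -> is_bubble y -> 1 <= i <= bsize x ->
      out_colour y = in_colour x i ->
      env_cong (graft (corolla x) i (corolla y)) (corolla (bnc_comp x i y))
  | ec_refl t : wf_tree t -> env_cong t t
  | ec_sym t t' : env_cong t t' -> env_cong t' t
  | ec_trans t t' t'' : env_cong t t' -> env_cong t' t'' -> env_cong t t''
  | ec_compl t t' i s : env_cong t t' -> wf_tree s -> 1 <= i <= arity t ->
      env_cong (graft t i s) (graft t' i s)
  | ec_compr s i t t' : wf_tree s -> 1 <= i <= arity s -> env_cong t t' ->
      env_cong (graft s i t) (graft s i t').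

(* phi : free operad -> CNCB induces an operad isomorphism Env(Bulle) ~ CNCB *)
Definition env_iso (phi : tree -> bnc) : Prop :=
  [/\ (forall t, wf_tree t -> is_bnc (phi t) /\ bsize (phi t) = arity t),
      phi Leaf = bnc_unit /\
      (forall t i s, wf_tree t -> wf_tree s -> 1 <= i <= arity t ->
          phi (graft t i s) = bnc_comp (phi t) i (phi s)),
      (forall t t', env_cong t t' -> phi t = phi t'),
      (forall t t', wf_tree t -> wf_tree t' -> phi t = phi t' -> env_cong t t')
    & (forall c, is_bnc c -> exists2 t, wf_tree t & phi t = c)].

(* Main.v *)
(* A tree is evaluated by composing, left to right, the evaluations of the
   children into the root bubble; the operad axioms of CNCB make this a morphism.
   Bubbles have no coloured diagonal, so a coloured diagonal of the value of a
   tree comes from gluing along an internal edge: the tree itself is a grafting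
   at that place, and the values of the two parts are recovered by cutting along
   the diagonal.  A tree with chordless value is congruent to a corolla, because
   an uncoloured gluing is exactly a composition defined in Bulle.  Injectivity
   and surjectivity modulo the congruence follow by induction on the arity,
   cutting along coloured diagonals until none is left. *)
Require Import Defs.
From mathcomp Require Import all_boot zify.

Set Implicit Arguments.
Unset Strict Implicit.
Unset Printing Implicit Defensive.

(** * Compositions of bicoloured noncrossing configurations *)

(** Hypotheses with conditionals are moved to the goal, where innermost conditions are split first
    and [lia] prunes each branch. *)
Ltac if_lia :=
  repeat match goal with H : context [if _ then _ else _] |- _ => revert H end;
  try lia;
  repeat (match goal with |- context [if ?c then _ else _] =>
    lazymatch c with
    | context [if _ then _ else _] => fail
    | _ => case: (boolP c) => ?
    end
  end; try lia).

Definition glue (c d : colour) : colour :=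
  match c, d with Unc, Unc => Red | Blue, Blue => Blue | _, _ => Unc end.

Lemma colour_eq_dec (c d : colour) : {c = d} + {c <> d}.
Proof. by decide equality. Qed.

Lemma col_mk n f i j :
  col (mk_bnc n f) i j = if (i < n.+2) && (j < n.+2) then f i j else Unc.
Proof.
rewrite /col /=; case: insubP => [a -> <-|/negbTE ->] //=.
case: insubP => [b -> <-|/negbTE ->] //=.
by rewrite ffunE.
Qed.

Lemma bnc_ext b b' :
  bsize b = bsize b' -> (forall i j, col b i j = col b' i j) -> b = b'.
Proof.
case: b b' => [n f] [n' f'] /= En; case: n' / En f' => f' Ef.
congr BNC; apply/ffunP => -[i j].
by have := Ef i j; rewrite /col /= !valK.
Qed.

Lemma bnc_size_gt0 b : is_bnc b -> 1 <= bsize b.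
Proof. by case. Qed.

Lemma col_arc b i j : is_bnc b -> col b i j <> Unc -> is_arc (bsize b) i j.
Proof. by case=> _ H _ _ _; apply: H. Qed.

Lemma col_Red b i j : is_bnc b -> col b i j = Red -> is_diagonal (bsize b) i j.
Proof. by case=> _ _ H _ _; apply: H. Qed.

Lemma col_noncrossing b i j k l : is_bnc b ->
  col b i j <> Unc -> col b k l <> Unc -> ~ crossing i j k l.
Proof. by case=> _ _ _ H _; apply: H. Qed.

Lemma col_not_arc b i j : is_bnc b -> ~ is_arc (bsize b) i j -> col b i j = Unc.
Proof.
move=> Hb Nij; case: (colour_eq_dec (col b i j) Unc) => // /(col_arc Hb).
by move/Nij.
Qed.

Lemma col_edge b i : is_bnc b -> {col b i i.+1 = Unc} + {col b i i.+1 = Blue}.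
Proof.
case=> _ _ H _ _; case E: (col b i i.+1); [by left | by right |].
by exfalso; have [_ []] := H _ _ E.
Qed.

Lemma col_base b :
  is_bnc b -> {col b 1 (bsize b).+1 = Unc} + {col b 1 (bsize b).+1 = Blue}.
Proof.
case=> _ _ H _ _; case E: (col b 1 _); [by left | by right |].
by exfalso; have [_ [_ []]] := H _ _ E.
Qed.

Lemma col_size1 b : is_bnc b -> bsize b = 1 -> col b 1 2 = Blue.
Proof. by case. Qed.

Lemma bnc_ext_arc b b' : is_bnc b -> is_bnc b' -> bsize b = bsize b' ->
  (forall i j, is_arc (bsize b) i j -> col b i j = col b' i j) -> b = b'.
Proof.
move=> Hb Hb' E H; apply: bnc_ext => // i j.
case: (boolP [&& 1 <= i, i < j & j <= (bsize b).+1]) => Hij.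
  by apply: H; rewrite /is_arc; lia.
by rewrite !col_not_arc // /is_arc; lia.
Qed.

Lemma bsize_comp C i D : bsize (bnc_comp C i D) = (bsize C + bsize D).-1.
Proof. by []. Qed.

(** The range test of [mk_bnc] can go: outside the range the gluing branch is impossible, and the
    others give [Unc] or read a pair that is no arc of [C] or [D]. *)
Lemma col_comp C i D a b : is_bnc C -> is_bnc D -> 1 <= i <= bsize C ->
  let m := bsize D in
  let unsig v := if v <= i then v else v - m.-1 in
  col (bnc_comp C i D) a b =
    if (a == i) && (b == i + m) then glue (col C i i.+1) (col D 1 m.+1)
    else if (i <= a) && (b <= i + m) then col D (a - i).+1 (b - i).+1
    else if ((a <= i) || (i + m <= a)) && ((b <= i) || (i + m <= b)) then
      col C (unsig a) (unsig b)
    else Unc.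
Proof.
move=> HC HD Hi m unsig; rewrite col_mk -/m.
have m1 : 1 <= m := bnc_size_gt0 HD.
case: ifP => // Hr.
case: ifP => [|_]; first by lia.
case: ifP => [?|_].
  by rewrite col_not_arc // /is_arc -/m; lia.
case: ifP => // ?; rewrite col_not_arc // /is_arc /unsig.
if_lia.
Qed.


(** Inversion on the origin of a coloured arc: the gluing arc, an arc of [D], or an arc of [C] moved
    by the vertex map of the composition. Questions about the composite thus reduce to its
    factors. *)
Lemma comp_coloured C i D a b : is_bnc C -> is_bnc D -> 1 <= i <= bsize C ->
  col (bnc_comp C i D) a b <> Unc ->
  [\/ [/\ a = i, b = i + bsize D &
        col (bnc_comp C i D) a b = glue (col C i i.+1) (col D 1 (bsize D).+1)],
      [/\ i <= a, a < b, b <= i + bsize D, ~ (a = i /\ b = i + bsize D) &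
        col (bnc_comp C i D) a b = col D (a - i).+1 (b - i).+1]
    | exists a' b', [/\ is_arc (bsize C) a' b', ~ (a' = i /\ b' = i.+1),
        a = (if a' <= i then a' else a' + (bsize D).-1),
        b = (if b' <= i then b' else b' + (bsize D).-1) &
        col (bnc_comp C i D) a b = col C a' b']].
Proof.
move=> HC HD Hi; rewrite col_comp //.
have m1 := bnc_size_gt0 HD.
case: ifP => [/andP[/eqP-> /eqP->] _|N1]; first by constructor 1.
case: ifP => [N2 /(col_arc HD)[A1 [A2 A3]]|N2].
  by constructor 2; split=> //; lia.
case: ifP => // N3 Hc; constructor 3.
have [A1 [A2 A3]] := col_arc HC Hc.
exists (if a <= i then a else a - (bsize D).-1),
       (if b <= i then b else b - (bsize D).-1); split=> //.
- if_lia.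
- if_lia.
- if_lia.
Qed.

Lemma glue_Red c d : glue c d = Red -> c = Unc /\ d = Unc.
Proof. by case: c; case: d. Qed.

Lemma comp_is_bnc C i D :
  is_bnc C -> is_bnc D -> 1 <= i <= bsize C -> is_bnc (bnc_comp C i D).
Proof.
move=> HC HD Hi; have m1 := bnc_size_gt0 HD.
have Harc a b : col (bnc_comp C i D) a b <> Unc ->
    is_arc (bsize (bnc_comp C i D)) a b.
  rewrite bsize_comp /is_arc.
  case/comp_coloured => // [[-> ->]|[]|[a' [b' [[A1 [A2 A3]] A4 -> ->]]]]; try lia.
  if_lia.
split=> //.
- by rewrite bsize_comp; lia.
- move=> a b Hc.
  have Hn : col (bnc_comp C i D) a b <> Unc by rewrite Hc.
  split; first exact: Harc.
  rewrite bsize_comp.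
  case/comp_coloured: Hn => // [[Ea Eb]|[A1 A2 A3 A4]|[a' [b' [[A1 [A2 A3]] A4 Ea Eb]]]].
  + rewrite Hc Ea Eb => /esym /glue_Red[Cu Du].
    (* A red gluing arc has two uncoloured sides, which excludes size 1, whose only arc is blue.
       With both sizes at least 2 the arc is a diagonal. *)
    have n2 : bsize C <> 1.
      move=> E; have := col_size1 HC E.
      have -> : 1 = i by lia.
      by rewrite Cu.
    have m2 : bsize D <> 1.
      by move=> E; have := col_size1 HD E; move: Du; rewrite E => ->.
    lia.
  + rewrite Hc => /esym /(col_Red HD)[B1 [B2 B3]].
    by lia.
  + rewrite Hc => /esym /(col_Red HC)[B1 [B2 B3]].
    by rewrite Ea Eb; if_lia.
- move=> a b c d; rewrite /crossing => H1 H2.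
  (* Arithmetic excludes a crossing as soon as the gluing arc is involved or the origins differ; two
     arcs of [D] or two arcs of [C] remain. *)
  case/(comp_coloured HC HD Hi): (H1) => [[Ea Eb _]|[A1 A2 A3 A4 Ec]|[a' [b' [[A1 [A2 A3]] A4 Ea Eb Ec]]]];
  case/(comp_coloured HC HD Hi): (H2) => [[Fa Fb _]|[B1 B2 B3 B4 Ed]|[c' [d' [[B1 [B2 B3]] B4 Fa Fb Ed]]]];
  try (by lia); try (by if_lia).
  + move: H1 H2; rewrite Ec Ed; move=> /(col_noncrossing HD)/[apply].
    by rewrite /crossing; lia.
  + move: H1 H2; rewrite Ec Ed; move=> /(col_noncrossing HC)/[apply].
    rewrite /crossing.
    if_lia.
- rewrite bsize_comp => E.
  have [C1 D1] : bsize C = 1 /\ bsize D = 1.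
    by have := bnc_size_gt0 HC; lia.
  rewrite col_comp // D1 (_ : i = 1); last lia.
  by rewrite /= (col_size1 HC C1) (col_size1 HD D1).
Qed.

(** * Unit and associativity axioms of CNCB *)

Lemma unit_is_bnc : is_bnc bnc_unit.
Proof.
have E i j : col bnc_unit i j <> Unc -> i = 1 /\ j = 2.
  by rewrite col_mk; do 2!case: ifP => //; lia.
split=> // [i j /E[-> ->]|i j Hr|i j k l /E[-> ->] /E[-> ->]|_].
- by rewrite /is_arc /=; lia.
- have [] : i = 1 /\ j = 2 by apply: E; rewrite Hr.
  by move=> Ei Ej; move: Hr; rewrite Ei Ej col_mk.
- by rewrite /crossing; lia.
- by rewrite col_mk.
Qed.

Lemma col_unit : col bnc_unit 1 2 = Blue.
Proof. by rewrite col_mk. Qed.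

Lemma bnc_size1 b : is_bnc b -> bsize b = 1 -> b = bnc_unit.
Proof.
move=> Hb E; apply: bnc_ext_arc => //; first exact: unit_is_bnc.
move=> i j; rewrite E => -[H1 [H2 H3]].
have [-> ->] : i = 1 /\ j = 2 by lia.
by rewrite col_unit col_size1.
Qed.

(** Gluing with a blue side preserves [Unc] and [Blue], the only colours a base can have. *)
Lemma comp_unit_l D : is_bnc D -> bnc_comp bnc_unit 1 D = D.
Proof.
move=> HD; have m1 := bnc_size_gt0 HD; have HU := unit_is_bnc.
apply: bnc_ext_arc => //; [exact: comp_is_bnc |].
move=> a b; rewrite /is_arc bsize_comp /= => -[H1 [H2 H3]].
rewrite col_comp //; case: ifP => [/andP[/eqP-> /eqP->]|_].
  rewrite col_unit add1n.
  by case: (col_base HD) => ->.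
case: ifP => N; last lia.
by congr col; lia.
Qed.

Lemma comp_unit_r C i : is_bnc C -> 1 <= i <= bsize C -> bnc_comp C i bnc_unit = C.
Proof.
move=> HC Hi; have HU := unit_is_bnc.
apply: bnc_ext_arc => //; [exact: comp_is_bnc | by rewrite bsize_comp /=; lia|].
move=> a b; rewrite /is_arc bsize_comp /= => -[H1 [H2 H3]].
rewrite col_comp //=; case: ifP => [/andP[/eqP-> /eqP->]|N0].
  by rewrite col_unit addn1; case: (col_edge i HC) => ->.
case: ifP => N; first lia.
case: ifP => N2; last lia.
by congr col; if_lia.
Qed.

(* Conditions settled by arithmetic are rewritten instead of split on, which
   keeps the case analysis in the operad axioms small. *)
Ltac decide_ifs :=
  repeat match goal with |- context [if ?c then _ else _] =>
    lazymatch c with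
    | context [if _ then _ else _] => fail
    | _ => first [ rewrite (_ : c = true); [|lia] | rewrite (_ : c = false); [|lia]
                 | case: (boolP c) => ? ]
    end
  end.

Lemma eq_col b x y z t : x = z -> y = t -> col b x y = col b z t.
Proof. by move=> -> ->. Qed.

Lemma eq_glue c d c' d' : c = c' -> d = d' -> glue c d = glue c' d'.
Proof. by move=> -> ->. Qed.

Ltac close_col :=
  lazymatch goal with
  | |- col ?b _ _ = col ?b _ _ => apply: eq_col; lia
  | |- glue _ _ = glue _ _ => apply: eq_glue; close_col
  | |- Unc = Unc => reflexivity
  end.

(** Sequential axiom. Once [D] has size at least 2, both sides amount to the same case distinction
    on the positions of [a] and [b]. *)
Lemma comp_seq C i D j E : is_bnc C -> is_bnc D -> is_bnc E ->
  1 <= i <= bsize C -> 1 <= j <= bsize D ->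
  bnc_comp (bnc_comp C i D) (i + j).-1 E = bnc_comp C i (bnc_comp D j E).
Proof.
move=> HC HD HE Hi Hj.
(* For bsize D = 1 the two gluing arcs coincide. *)
have [D1|D2] : bsize D = 1 \/ 2 <= bsize D by lia.
  rewrite (bnc_size1 HD D1) (_ : j = 1); last lia.
  by rewrite addn1 /= comp_unit_r // comp_unit_l.
have l1 := bnc_size_gt0 HE.
have HCD := comp_is_bnc HC HD Hi; have HDE := comp_is_bnc HD HE Hj.
apply: bnc_ext_arc; [by apply: comp_is_bnc => //; rewrite bsize_comp; lia
  | exact: comp_is_bnc | by rewrite !bsize_comp; lia |].
move=> a b; rewrite /is_arc !bsize_comp => -[A1 [A2 A3]].
rewrite (col_comp _ _ HCD HE) ?bsize_comp; last lia.
rewrite (col_comp _ _ HC HDE) // ?bsize_comp.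
rewrite !(col_comp _ _ HC HD) // !(col_comp _ _ HD HE) //.
(* Sizes and positions become successors, so that the predecessors in the index formulas compute
   away. *)
have [m Em] : exists m, bsize D = m.+2 by exists (bsize D).-2; lia.
have [l El] : exists l, bsize E = l.+1 by exists (bsize E).-1; lia.
case: i j Hi Hj {HC HD HE HCD HDE D2 l1} A1 A2 A3 => // i [|j] // Hi Hj.
rewrite Em El ?addSn ?addnS /= => A1 A2 A3.
rewrite {}Em {El} in Hj *; move: (bsize C) => n in Hi A3 *.
decide_ifs; close_col.
Qed.

(** Parallel axiom: the kth edge of [C] moves right because [D] replaces one edge to its left by
    [bsize D] edges. *)
Lemma comp_par C i D k E : is_bnc C -> is_bnc D -> is_bnc E ->
  1 <= i -> i < k <= bsize C ->
  bnc_comp (bnc_comp C i D) (k + bsize D).-1 E = bnc_comp (bnc_comp C k E) i D.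
Proof.
move=> HC HD HE Hi Hk.
have m1 := bnc_size_gt0 HD; have l1 := bnc_size_gt0 HE.
have HCD : is_bnc (bnc_comp C i D) by apply: comp_is_bnc => //; lia.
have HCE : is_bnc (bnc_comp C k E) by apply: comp_is_bnc => //; lia.
apply: bnc_ext_arc; [by apply: comp_is_bnc => //; rewrite bsize_comp; lia
  | by apply: comp_is_bnc => //; rewrite bsize_comp; lia
  | by rewrite !bsize_comp; lia |].
move=> a b; rewrite /is_arc !bsize_comp => -[A1 [A2 A3]].
rewrite (col_comp _ _ HCD HE) ?bsize_comp; last lia.
rewrite (col_comp _ _ HCE HD) ?bsize_comp; last lia.
rewrite !(col_comp _ _ HC HD) ?(col_comp _ _ HC HE); try lia.
have [m Em] : exists m, bsize D = m.+1 by exists (bsize D).-1; lia.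
have [l El] : exists l, bsize E = l.+1 by exists (bsize E).-1; lia.
case: i k Hi Hk {HC HD HE HCD HCE m1 l1} A1 A2 A3 => // i [|k] // Hi Hk.
rewrite {}Em {}El ?addSn ?addnS /= => A1 A2 A3.
move: (bsize C) => n in Hk A3 *.
decide_ifs; close_col.
Qed.

(** * Grafting and evaluation of trees *)

Fixpoint forest_arity (ts : seq tree) : nat :=
  match ts with [::] => 0 | t :: ts' => arity t + forest_arity ts' end.

Fixpoint wf_forest (ts : seq tree) : Prop :=
  match ts with [::] => True | t :: ts' => wf_tree t /\ wf_forest ts' end.

(* The parameter s stays outside the fixpoint so that graft unfolds to it. *)
Definition forest_graft (s : tree) := fix go (ts : seq tree) (i : nat) :=
  match ts with
  | [::] => [::]
  | t :: ts' => if (1 <= i) && (i <= arity t) then graft t i s :: ts'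
                else t :: go ts' (i - arity t)
  end.

Lemma arity_Node x ts : arity (Node x ts) = forest_arity ts.
Proof. by []. Qed.

Lemma wf_Node x ts : wf_tree (Node x ts) =
  [/\ is_bubble x, size ts = bsize x & wf_forest ts].
Proof. by []. Qed.

Lemma graft_Node x ts i s : graft (Node x ts) i s = Node x (forest_graft s ts i).
Proof. by []. Qed.

(** Joint induction on trees and lists of children, as [tree] is nested through [seq]; [Q] carries
    the statement along the list. *)
Lemma tree_forest_ind (P : tree -> Prop) (Q : seq tree -> Prop) :
  P Leaf -> (forall x ts, Q ts -> P (Node x ts)) ->
  Q [::] -> (forall t ts, P t -> Q ts -> Q (t :: ts)) ->
  (forall t, P t) /\ (forall ts, Q ts).
Proof.
move=> PL PN Q0 Q1.
have HP : forall t, P t.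
  fix IH 1 => -[|x ts]; first exact: PL.
  apply: PN; elim: ts => [|t ts IHts]; first exact: Q0.
  by apply: Q1; [exact: IH | exact: IHts].
by split=> //; elim=> // t ts; apply: Q1.
Qed.

Lemma arity_bounds :
  (forall t, wf_tree t -> 1 <= arity t) /\
  (forall ts, wf_forest ts -> size ts <= forest_arity ts).
Proof.
apply: tree_forest_ind => // [x ts IH|t ts IHt IHts] /=.
  by case=> -[_ x2 _] Es /IH; rewrite -/(forest_arity ts); lia.
by case=> /IHt ? /IHts ?; lia.
Qed.

Lemma arity_gt0 t : wf_tree t -> 1 <= arity t.
Proof. exact: (proj1 arity_bounds). Qed.

Lemma arity_graft t i s :
  1 <= i <= arity t -> arity (graft t i s) = (arity t + arity s).-1.
Proof.
move: t i; suff [] : (forall t i, 1 <= i <= arity t ->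
    arity (graft t i s) = (arity t + arity s).-1) /\
  (forall ts i, 1 <= i <= forest_arity ts ->
    forest_arity (forest_graft s ts i) = (forest_arity ts + arity s).-1) by [].
apply: tree_forest_ind => [i /= Hi|x ts IH i|i /=|t ts IHt IHts i Hi].
- by rewrite (_ : i = 1) //=; lia.
- by rewrite graft_Node !arity_Node; apply: IH.
- by lia.
- rewrite /= in Hi *; case: ifP => Ht /=.
    by rewrite IHt //; lia.
  by rewrite IHts; lia.
Qed.

Lemma size_forest_graft s ts i : size (forest_graft s ts i) = size ts.
Proof. by elim: ts i => //= t ts IH i; case: ifP => //= _; rewrite IH. Qed.

Lemma wf_graft t i s : wf_tree t -> wf_tree s -> wf_tree (graft t i s).
Proof.
move=> Ht Hs; move: t i Ht; suff [] : (forall t i, wf_tree t -> wf_tree (graft t i s)) /\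
  (forall ts i, wf_forest ts -> wf_forest (forest_graft s ts i)) by [].
apply: tree_forest_ind => [i _ /=|x ts IH i|//|t ts IHt IHts i [Ht Hts]].
- by case: ifP.
- by rewrite graft_Node !wf_Node size_forest_graft => -[? ? /(IH i) ?].
- by rewrite /=; case: ifP => _ /=; split=> //; [exact: IHt | exact: IHts].
Qed.

(** Sequential axiom of the free operad: both grafts descend into the same child until leaf [i] is
    reached. *)
Lemma graft_seq t i s j r : 1 <= i <= arity t -> 1 <= j <= arity s ->
  graft (graft t i s) (i + j).-1 r = graft t i (graft s j r).
Proof.
move=> Hi Hj; move: t i Hi; suff [] : (forall t i, 1 <= i <= arity t ->
    graft (graft t i s) (i + j).-1 r = graft t i (graft s j r)) /\
  (forall ts i, 1 <= i <= forest_arity ts ->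
    forest_graft r (forest_graft s ts i) (i + j).-1 =
    forest_graft (graft s j r) ts i) by [].
apply: tree_forest_ind => [i Hi|x ts IH i|i /=|t ts IHt IHts i Hi].
- by rewrite (_ : i = 1) //=; move: Hi => /=; lia.
- by rewrite !graft_Node arity_Node => /IH ->.
- by lia.
- rewrite /= in Hi *; case: ifP => Ht /=.
    rewrite arity_graft // ifT; last lia.
    by rewrite IHt.
  rewrite ifF; last lia.
  by rewrite -IHts; [congr (_ :: forest_graft _ _ _)|]; lia.
Qed.

(** Parallel axiom of the free operad. At a forest, leaves [i] and [k] lie both in the first child,
    on either side of its end, or both in the tail. *)
Lemma graft_par t i s k r : 1 <= i -> i < k <= arity t -> 1 <= arity s ->
  1 <= arity r ->
  graft (graft t i s) (k + arity s).-1 r = graft (graft t k r) i s.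
Proof.
move=> Hi Hk Hs Hr; move: t i k Hi Hk; suff [] :
  (forall t i k, 1 <= i -> i < k <= arity t ->
    graft (graft t i s) (k + arity s).-1 r = graft (graft t k r) i s) /\
  (forall ts i k, 1 <= i -> i < k <= forest_arity ts ->
    forest_graft r (forest_graft s ts i) (k + arity s).-1 =
    forest_graft s (forest_graft r ts k) i) by [].
apply: tree_forest_ind => [i k /=|x ts IH i k Hi|i k /=|t ts IHt IHts i k Hi Hk].
- by lia.
- by rewrite !graft_Node arity_Node => /(IH _ _ Hi) ->.
- by lia.
- rewrite /= in Hk *; case: (boolP ((1 <= i) && (i <= arity t))) => Hit /=.
  + rewrite arity_graft //; case: ifP => Hkt.
      rewrite ifT /=; last lia.
      by rewrite arity_graft ?ifT ?IHt //; lia.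
    rewrite ifF /=; last lia.
    rewrite Hit; congr (_ :: forest_graft _ _ _); lia.
  + rewrite ifF; last lia.
    rewrite ifF /=; last lia.
    rewrite (negbTE Hit) -IHts; [congr (_ :: forest_graft _ _ _)| |]; lia.
Qed.

Lemma forest_arity_nseq n : forest_arity (nseq n Leaf) = n.
Proof. by elim: n => //= n ->. Qed.

Lemma arity_corolla x : arity (corolla x) = bsize x.
Proof. by rewrite arity_Node forest_arity_nseq. Qed.

Lemma wf_corolla x : is_bubble x -> wf_tree (corolla x).
Proof. by rewrite wf_Node size_nseq; split=> //; elim: (bsize x) => /=. Qed.

(** The rightmost child that is not a leaf is pruned, leaving a leaf in its place. Both parts have
    arity at least 2, hence smaller arity than [t], which is what induction on the arity needs. *)
Lemma tree_cases t : wf_tree t ->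
  [\/ t = Leaf, (exists2 x, is_bubble x & t = corolla x)
    | exists t1 i t2, [/\ t = graft t1 i t2, wf_tree t1, wf_tree t2,
        1 <= i <= arity t1 & 2 <= arity t1 /\ 2 <= arity t2]].
Proof.
case: t => [|x ts]; first by constructor 1.
rewrite wf_Node => -[Hx Es Hts].
have [E|] : ts = nseq (size ts) Leaf \/ exists ts1 i s,
    [/\ ts = forest_graft s ts1 i, wf_forest ts1, wf_tree s,
        1 <= i <= forest_arity ts1 & size ts1 = size ts /\ 2 <= arity s].
  elim: ts {Es} Hts => [|t ts IH]; first by left.
  case=> Ht /[dup] Hts /IH[E|[ts1 [i [s [-> H1 H2 H3 [H4 H5]]]]]]; last first.
    right; exists (t :: ts1), (arity t + i), s; split=> //=; try lia.
    by rewrite ifF ?addKn //; lia.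
  case: t Ht => [_|y us Hy]; first by left; rewrite {1}E.
  right; exists (Leaf :: ts), 1, (Node y us); split=> //=.
  case: Hy => -[_ y2 _] Eu /(proj2 arity_bounds).
  by rewrite /= -/(forest_arity us); lia.
  by constructor 2; exists x; rewrite // /corolla -Es -E.
case=> ts1 [i [s [Ets H1 H2 H3 [H4 H5]]]]; constructor 3.
have H6 : wf_tree (Node x ts1) by rewrite wf_Node H4.
exists (Node x ts1), i, s; split=> //; first by rewrite graft_Node -Ets.
case: Hx => _ x2 _; have := proj2 arity_bounds _ H1.
by rewrite arity_Node; lia.
Qed.

(** * Evaluation as a morphism of operads *)

Fixpoint eval (t : tree) : bnc :=
  match t with
  | Leaf => bnc_unit
  | Node x ts =>
      (fix go (C : bnc) (i : nat) (ts : seq tree) := match ts with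
       | [::] => C
       | t1 :: ts' => go (bnc_comp C i (eval t1)) (i + arity t1) ts'
       end) x 1 ts
  end.

(** The inner loop of [eval], named for induction. The position advances by the arity of each child,
    so [i] is always the next edge of the root not yet composed. *)
Fixpoint comp_forest (C : bnc) (i : nat) (ts : seq tree) : bnc :=
  match ts with
  | [::] => C
  | t :: ts' => comp_forest (bnc_comp C i (eval t)) (i + arity t) ts'
  end.

Lemma eval_Node x ts : eval (Node x ts) = comp_forest x 1 ts.
Proof. by []. Qed.

(** The bound on [i + size ts] says that enough edges remain from the ith one on to receive all
    children. *)
Lemma eval_forest :
  (forall t, wf_tree t -> is_bnc (eval t) /\ bsize (eval t) = arity t) /\
  (forall ts C i, wf_forest ts -> is_bnc C -> 1 <= i -> i + size ts <= (bsize C).+1 ->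
     is_bnc (comp_forest C i ts) /\
     (bsize (comp_forest C i ts) + size ts = bsize C + forest_arity ts)).
Proof.
apply: tree_forest_ind => [_|x ts IH|C i _|t ts IHt IHts C i].
- by split=> //; exact: unit_is_bnc.
- rewrite wf_Node arity_Node eval_Node => -[[Hx x2 _] Es Hts].
  have [] := IH x 1 Hts Hx isT; first by lia.
  by split=> //; lia.
- by split=> //=; rewrite addn0.
- case=> Ht Hts HC Hi /= Es; have [B1 B2] := IHt Ht; have A := arity_gt0 Ht.
  have HCt : is_bnc (bnc_comp C i (eval t)) by apply: comp_is_bnc => //; lia.
  have [] := IHts (bnc_comp C i (eval t)) (i + arity t) Hts HCt; rewrite ?bsize_comp.
  + by lia.
  + by lia.
  + by move=> ? ?; split=> //; lia.
Qed.

Lemma eval_is_bnc t : wf_tree t -> is_bnc (eval t).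
Proof. by case/(proj1 eval_forest). Qed.

Lemma bsize_eval t : wf_tree t -> bsize (eval t) = arity t.
Proof. by case/(proj1 eval_forest). Qed.

(** By the parallel axiom, a composition on an edge left of all children still to come can be done
    before them. *)
Lemma comp_forest_par ts C i k S : wf_forest ts -> is_bnc C -> is_bnc S ->
  1 <= i -> i < k -> k + size ts <= (bsize C).+1 ->
  bnc_comp (comp_forest C k ts) i S =
  comp_forest (bnc_comp C i S) (k + bsize S).-1 ts.
Proof.
elim: ts C k => [//|t ts IH] C k [Ht Hts] HC HS Hi Hk /= Es.
have A := arity_gt0 Ht; have Et := bsize_eval Ht; have Bt := eval_is_bnc Ht.
rewrite IH //; [|by apply: comp_is_bnc => //; lia|by lia|by rewrite bsize_comp; lia].
rewrite -comp_par //; last lia.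
congr comp_forest; have := bnc_size_gt0 HS; lia.
Qed.

Lemma eval_graft t i s : wf_tree t -> wf_tree s -> 1 <= i <= arity t ->
  eval (graft t i s) = bnc_comp (eval t) i (eval s).
Proof.
move=> Ht Hs; have Bs := eval_is_bnc Hs; have s1 := arity_gt0 Hs.
have Es := bsize_eval Hs; move: t i Ht; suff [] :
  (forall t i, wf_tree t -> 1 <= i <= arity t ->
    eval (graft t i s) = bnc_comp (eval t) i (eval s)) /\
  (forall ts C k i, wf_forest ts -> is_bnc C -> 1 <= k -> k + size ts <= (bsize C).+1 ->
    1 <= i <= forest_arity ts ->
    comp_forest C k (forest_graft s ts i) =
    bnc_comp (comp_forest C k ts) (k + i).-1 (eval s)) by [].
apply: tree_forest_ind => [i _|x ts IH i|C k i _ _ _ _ /=|t ts IHt IHts C k i].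
- by move=> /= Hi; rewrite (_ : i = 1) /= ?comp_unit_l //; lia.
- rewrite graft_Node !eval_Node wf_Node arity_Node => -[[Hx x2 _] Ez Hts] Hi.
  by rewrite IH //; lia.
- by lia.
- case=> Ht Hts HC Hk /= Ez Hi.
  have A := arity_gt0 Ht; have Et := bsize_eval Ht; have Bt := eval_is_bnc Ht.
  have HCt : is_bnc (bnc_comp C k (eval t)) by apply: comp_is_bnc => //; lia.
  case: ifP => Hit /=.
    (* The sequential axiom pulls [s] out of the child containing leaf [i]; the parallel axiom then
       carries it past the later children. *)
    rewrite IHt // arity_graft // -comp_seq //; try lia.
    rewrite comp_forest_par //; try lia; last by rewrite bsize_comp; lia.
    by congr comp_forest; lia.
  rewrite IHts //; try lia; last by rewrite bsize_comp; lia.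
  by congr bnc_comp; lia.
Qed.

(** * Cutting along a coloured diagonal *)

Lemma col_comp_glue C i D : is_bnc C -> is_bnc D -> 1 <= i <= bsize C ->
  col (bnc_comp C i D) i (i + bsize D) =
  glue (col C i i.+1) (col D 1 (bsize D).+1).
Proof. by move=> HC HD Hi; rewrite col_comp // !eqxx. Qed.

Lemma col_comp_r C i D a b : is_bnc C -> is_bnc D -> 1 <= i <= bsize C ->
  is_arc (bsize D) a b -> ~ (a = 1 /\ b = (bsize D).+1) ->
  col (bnc_comp C i D) (a + i).-1 (b + i).-1 = col D a b.
Proof.
move=> HC HD Hi [A1 [A2 A3]] N; rewrite col_comp // ifF; last lia.
by rewrite ifT; last lia; apply: eq_col; lia.
Qed.

(** The vertex map σ of the composition at [i] with a configuration of size [m]. *)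
Definition shift (i m v : nat) := if v <= i then v else v + m.-1.

Lemma col_comp_l C i D a b : is_bnc C -> is_bnc D -> 1 <= i <= bsize C ->
  is_arc (bsize C) a b -> ~ (a = i /\ b = i.+1) ->
  col (bnc_comp C i D) (shift i (bsize D) a) (shift i (bsize D) b) = col C a b.
Proof.
move=> HC HD Hi [A1 [A2 A3]] N; have m1 := bnc_size_gt0 HD.
rewrite col_comp // /shift; case: (leqP a i) => Ha; case: (leqP b i) => Hb.
all: rewrite ifF; last lia.
all: rewrite ifF; last lia.
all: rewrite ifT; last lia.
all: by rewrite ?Ha ?Hb; apply: eq_col; if_lia.
Qed.

(* The common colour of the two sides glued along a diagonal coloured c. *)
Definition half (c : colour) : colour := if c is Red then Unc else Blue.

(** The piece of [c] on the base side of the diagonal [(i, i + m)], which becomes its ith edge. *)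
Definition base_part (c : bnc) (i m : nat) : bnc :=
  mk_bnc (bsize c - m.-1) (fun a b => if (a == i) && (b == i.+1)
    then half (col c i (i + m)) else col c (shift i m a) (shift i m b)).

(** The piece on the other side, with the diagonal as base. The guard on [a] keeps the dummy vertex
    0 from being sent to the vertex [i - 1] of [c]. *)
Definition top_part (c : bnc) (i m : nat) : bnc :=
  mk_bnc m (fun a b => if (a == 1) && (b == m.+1) then half (col c i (i + m))
    else if 1 <= a then col c (a + i).-1 (b + i).-1 else Unc).

Lemma col_base_part c i m a b : is_bnc c -> is_diagonal (bsize c) i (i + m) ->
  col (base_part c i m) a b = if (a == i) && (b == i.+1)
    then half (col c i (i + m)) else col c (shift i m a) (shift i m b).
Proof.
move=> Hc [[A1 [A2 A3]] [N1 N2]]; rewrite col_mk; case: ifP => // H.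
rewrite ifF; last lia.
by rewrite col_not_arc // /is_arc /shift; if_lia.
Qed.

Lemma col_top_part c i m a b : is_arc m a b -> col (top_part c i m) a b = if (a == 1) && (b == m.+1)
    then half (col c i (i + m)) else col c (a + i).-1 (b + i).-1.
Proof.
move=> [A1 [A2 A3]]; rewrite col_mk ifT; last lia.
by rewrite A1.
Qed.

Lemma half_Red c : half c <> Red.
Proof. by case: c. Qed.

(** The cut side is an edge, so it crosses nothing, and [half] never makes it red. For the other
    arcs, [shift] is increasing, so a crossing would already occur in [c]. *)
Lemma base_part_is_bnc c i m : is_bnc c -> is_diagonal (bsize c) i (i + m) ->
  is_bnc (base_part c i m).
Proof.
move=> Hc Hd; have [[A1 [A2 A3]] [N1 N2]] := Hd.
split=> /=.
- by lia.
- move=> a b; rewrite col_base_part //.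
  case: ifP => [H _|_ /(col_arc Hc)]; rewrite /is_arc /shift; if_lia.
- move=> a b; rewrite col_base_part //.
  case: ifP => [_ /half_Red //|N /(col_Red Hc)].
  by rewrite /is_diagonal /is_arc /shift; if_lia.
- move=> a b k l; rewrite !col_base_part // /crossing.
  case: ifP => [H1 _|N3 H1]; case: ifP => [H2 _|N4 H2]; try by lia.
  have := col_noncrossing Hc H1 H2; have [B1 [B2 B3]] := col_arc Hc H1.
  have [B4 [B5 B6]] := col_arc Hc H2.
  by rewrite /crossing {H1 H2}; rewrite /shift in B1 B2 B3 B4 B5 B6 *; if_lia.
- by lia.
Qed.

Lemma top_part_is_bnc c i m : is_bnc c -> is_diagonal (bsize c) i (i + m) ->
  is_bnc (top_part c i m).
Proof.
move=> Hc Hd; have [[A1 [A2 A3]] [N1 N2]] := Hd.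
have Harc a b : col (top_part c i m) a b <> Unc -> is_arc m a b.
  rewrite col_mk /is_arc; case: ifP => // H; case: ifP => [|_]; first by lia.
  by case: ifP => // Ha /(col_arc Hc); rewrite /is_arc; lia.
split=> //=.
- by lia.
- move=> a b H; have Hab : is_arc m a b by apply: Harc; rewrite H.
  move: H; rewrite col_top_part //.
  case: ifP => [_ /half_Red //|N /(col_Red Hc)].
  by move: Hab; rewrite /is_diagonal /is_arc; lia.
- move=> a b k l H1 H2; have B1 := Harc _ _ H1; have B2 := Harc _ _ H2.
  move: H1 H2; rewrite !col_top_part //; rewrite /is_arc in B1 B2; rewrite /crossing.
  case: ifP => [H1 _|N3 H1]; case: ifP => [H2 _|N4 H2]; try by lia.
  have := col_noncrossing Hc H1 H2.
  by rewrite /crossing; lia.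
- by lia.
Qed.

Lemma comp_parts c i m : is_bnc c -> is_diagonal (bsize c) i (i + m) ->
  col c i (i + m) <> Unc ->
  bnc_comp (base_part c i m) i (top_part c i m) = c.
Proof.
move=> Hc Hd Hn; have HC := base_part_is_bnc Hc Hd.
have HD := top_part_is_bnc Hc Hd; have [[A1 [A2 A3]] [N1 N2]] := Hd.
have Hi : 1 <= i <= bsize (base_part c i m) by rewrite /=; lia.
apply: bnc_ext_arc => //; first exact: comp_is_bnc.
  by rewrite bsize_comp /=; lia.
move=> a b; rewrite bsize_comp => /= -[B1 [B2 B3]].
rewrite col_comp //= col_base_part //.
case: ifP => [/andP[/eqP-> /eqP->]|N3].
  rewrite !eqxx col_top_part ?eqxx //=; last by rewrite /is_arc; lia.
  by case: (col c _ _) Hn.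
case: ifP => N4.
  rewrite col_top_part //; last by rewrite /is_arc; lia.
  rewrite ifF; last lia.
  by apply: eq_col; lia.
case: ifP => N5.
  rewrite col_base_part // ifF; last by if_lia.
  by apply: eq_col; rewrite /shift; if_lia.
(* An arc lying in neither part crosses the coloured diagonal, hence is uncoloured. *)
case: (colour_eq_dec (col c a b) Unc) => // /(col_noncrossing Hc Hn) X.
by exfalso; apply: X; rewrite /crossing; lia.
Qed.

Lemma half_glue c d : c <> Red -> d <> Red -> glue c d <> Unc ->
  half (glue c d) = c /\ half (glue c d) = d.
Proof. by case: c; case: d. Qed.

(** A coloured gluing arc forces its two sides to have the same colour, which [half] reads back. So
    the factorisation along a coloured diagonal is unique. *)
Lemma parts_comp C i D : is_bnc C -> is_bnc D -> 1 <= i <= bsize C ->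
  let c := bnc_comp C i D in let m := bsize D in
  is_diagonal (bsize c) i (i + m) -> col c i (i + m) <> Unc ->
  base_part c i m = C /\ top_part c i m = D.
Proof.
move=> HC HD Hi c m Hd; have Hc : is_bnc c by exact: comp_is_bnc.
have m1 : 1 <= m := bnc_size_gt0 HD.
rewrite col_comp_glue // => /half_glue [].
- by case: (col_edge i HC) => ->.
- by case: (col_base HD) => ->.
move=> E1 E2; split.
  apply: bnc_ext_arc => //; first exact: base_part_is_bnc.
    by rewrite /= -/m; lia.
  move=> a b /=; rewrite -/m => -[A1 [A2 A3]].
  rewrite col_base_part // col_comp_glue // E1.
  case: ifP => [/andP[/eqP-> /eqP->] //|N].
  by apply: col_comp_l => //; rewrite /is_arc; lia.
apply: bnc_ext_arc => //; first exact: top_part_is_bnc.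
move=> a b Hab; rewrite col_top_part // col_comp_glue // E2.
case: ifP => [/andP[/eqP-> /eqP->] //|N].
by apply: col_comp_r => //; rewrite -/m; lia.
Qed.

Lemma eval_corolla x : is_bubble x -> eval (corolla x) = x.
Proof.
case=> Hx _ _; rewrite eval_Node.
suff H n i : 1 <= i -> i + n <= (bsize x).+1 ->
    comp_forest x i (nseq n Leaf) = x by exact: H.
elim: n i => // n IH i Hi Hn.
by rewrite /= comp_unit_r ?IH //; lia.
Qed.

(** * Coloured diagonals and chordless values of trees *)

Definition chordless (c : bnc) : Prop :=
  forall i j, is_diagonal (bsize c) i j -> col c i j = Unc.

(** The diagonal is the arc glued in a splitting of [t], or comes from one of the two parts. In the
    latter case the splitting of that part, given by induction, is transported to [t] by the axioms
    of grafting. *)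
Lemma eval_chord t i j : wf_tree t -> is_diagonal (arity t) i j ->
  col (eval t) i j <> Unc ->
  exists t1 t2, [/\ t = graft t1 i t2, wf_tree t1, wf_tree t2,
    1 <= i <= arity t1 & j = i + arity t2].
Proof.
have [n] := ubnP (arity t); elim: n t i j => // n IH t i j /ltnSE Hn Ht Hd Hc.
case: (tree_cases Ht) => [Et|[x Hx Et]|[t1 [k [t2 [Et H1 H2 Hk [L1 L2]]]]]].
- by move: Hd; rewrite Et /is_diagonal /is_arc /=; lia.
- move: Hc Hd; rewrite Et eval_corolla // arity_corolla => Hc.
  by case: Hx => _ _ /[apply].
have B1 := eval_is_bnc H1; have B2 := eval_is_bnc H2.
have S1 := bsize_eval H1; have S2 := bsize_eval H2.
have Hk' : 1 <= k <= bsize (eval t1) by rewrite S1.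
move: (Hd) (Hc) Hn; rewrite Et arity_graft // eval_graft // => Hd' Hc' Hn.
case: Hd' => -[A1 [A2 A3]] [N1 N2].
case: (comp_coloured B1 B2 Hk' Hc') => [[-> -> _]|[C1 C2 C3 C4 Ec]|].
- by exists t1, t2; rewrite S2.
- have [] := IH t2 (i - k).+1 (j - k).+1 _ H2; rewrite -?Ec //; first by lia.
    by rewrite /is_diagonal /is_arc; lia.
  move=> u1 [u2 [Eu Hu1 Hu2 Hi Hj]].
  have Au : arity t2 = (arity u1 + arity u2).-1 by rewrite Eu arity_graft.
  exists (graft t1 k u1), u2; split=> //.
  + by rewrite Eu -graft_seq //; congr graft; lia.
  + exact: wf_graft.
  + by rewrite arity_graft //; lia.
  + by lia.
case=> a [b [[D1 [D2 D3]] D4 Ea Eb Ec]].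
have [] := IH t1 a b _ H1; rewrite -?Ec //; first by lia.
  by move: Ea Eb; rewrite /is_diagonal /is_arc -S1; if_lia.
move=> u1 [u2 [Eu Hu1 Hu2 Ha Hb]].
have Au : arity t1 = (arity u1 + arity u2).-1 by rewrite Eu arity_graft.
have G1 := arity_gt0 Hu1; have G2 := arity_gt0 Hu2.
(* The leaf [k] of [t1] that receives [t2] lies left of [u2], inside [u2], or right of it;
   accordingly [t2] joins [u1], [u2] or [u1]. *)
case: (ltnP k a) => Hka.
  exists (graft u1 k t2), u2; split=> //.
  + rewrite Eu -graft_par //; try lia.
    by congr graft; move: Ea; if_lia.
  + exact: wf_graft.
  + by rewrite arity_graft; move: Ea; if_lia.
  + by move: Ea Eb; if_lia.
case: (ltnP k b) => Hkb.
  exists u1, (graft u2 (k - a).+1 t2); split=> //.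
  + rewrite Eu (_ : i = a); last by move: Ea; if_lia.
    by rewrite -graft_seq //; [congr graft|]; lia.
  + exact: wf_graft.
  + by move: Ea; if_lia.
  + by rewrite arity_graft; [move: Ea Eb; if_lia | lia].
exists (graft u1 (k - arity u2).+1 t2), u2; split=> //.
+ rewrite Eu (_ : i = a); last by move: Ea; if_lia.
  by rewrite -(@graft_par u1 a u2) //; try lia; congr graft; lia.
+ exact: wf_graft.
+ by rewrite arity_graft; move: Ea; if_lia.
+ by move: Ea Eb; if_lia.
Qed.

(** The two colours of Bulle are chosen so that composability means one blue and one uncoloured
    side, that is, gluing leaves no chord. *)
Lemma composable_glue x i y : is_bnc x -> is_bnc y ->
  out_colour y = in_colour x i <->
  glue (col x i i.+1) (col y 1 (bsize y).+1) = Unc.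
Proof.
move=> Hx Hy; rewrite /out_colour /in_colour.
by case: (col_edge i Hx) => ->; case: (col_base Hy) => ->.
Qed.

Lemma chordless_comp C i D : is_bnc C -> is_bnc D -> 1 <= i <= bsize C ->
  2 <= bsize C -> 2 <= bsize D ->
  chordless (bnc_comp C i D) <->
  [/\ chordless C, chordless D & out_colour D = in_colour C i].
Proof.
move=> HC HD Hi n2 m2; have Hg := composable_glue i HC HD; split.
  rewrite /chordless bsize_comp => H; split.
  - move=> a b [[A1 [A2 A3]] [N1 N2]].
    rewrite -(col_comp_l HC HD Hi) //; last lia.
    by apply: H; rewrite /is_diagonal /is_arc /shift; if_lia.
  - move=> a b [[A1 [A2 A3]] [N1 N2]].
    rewrite -(col_comp_r HC HD Hi) //.
    by apply: H; rewrite /is_diagonal /is_arc; lia.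
  (* Both sizes being at least 2, the gluing arc is itself a diagonal of the composite. *)
  - by apply/Hg; rewrite -col_comp_glue // H // /is_diagonal /is_arc; lia.
case=> chC chD /Hg Eg a b [[A1 [A2 A3]] [N1 N2]].
rewrite bsize_comp in A3 N2.
case: (colour_eq_dec (col (bnc_comp C i D) a b) Unc) => // Hn.
case: (comp_coloured HC HD Hi Hn) => [[_ _ ->]|[C1 C2 C3 C4 ->]|]; first exact: Eg.
  by apply: chD; rewrite /is_diagonal /is_arc; lia.
case=> a' [b' [[D1 [D2 D3]] D4 Ea Eb ->]].
by apply: chC; move: Ea Eb; rewrite /is_diagonal /is_arc; if_lia.
Qed.

Lemma comp_bubble x i y : is_bubble x -> is_bubble y -> 1 <= i <= bsize x ->
  out_colour y = in_colour x i -> is_bubble (bnc_comp x i y).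
Proof.
move=> [Hx x2 Cx] [Hy y2 Cy] Hi Hxy; split; first exact: comp_is_bnc.
  by rewrite bsize_comp; lia.
by apply/chordless_comp.
Qed.

(** * Evaluation and the congruence *)

Lemma env_cong_sound t t' :
  env_cong t t' -> [/\ wf_tree t, wf_tree t' & eval t = eval t'].
Proof.
elim=> {t t'} [x i y Hx Hy Hi Hxy|t //|t t' _ []//|t t' t'' _ [H1 H2 ->] _ []//
  |t t' i s _ [H1 H2 E] Hs Hi|s i t t' Hs Hi _ [H1 H2 E]].
- have [Wx Wy] := (wf_corolla Hx, wf_corolla Hy).
  have Hc := comp_bubble Hx Hy Hi Hxy.
  split; [exact: wf_graft | exact: wf_corolla |].
  by rewrite eval_graft ?arity_corolla // !eval_corolla.
(* Congruent trees have equal values, hence equal arities, so position [i] is valid in both. *)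
- have Ea : arity t = arity t' by rewrite -!bsize_eval // E.
  by split; rewrite ?eval_graft -?Ea ?E //; exact: wf_graft.
- by split; rewrite ?eval_graft ?E //; exact: wf_graft.
Qed.

Lemma env_cong_graft t t' i s s' : env_cong t t' -> env_cong s s' ->
  1 <= i <= arity t -> env_cong (graft t i s) (graft t' i s').
Proof.
move=> Ht Hs Hi; have [W1 W2 E] := env_cong_sound Ht.
have [W3 W4 _] := env_cong_sound Hs.
apply: ec_trans (ec_compl Ht W3 Hi) _; apply: ec_compr => //.
by rewrite -(bsize_eval W2) -E bsize_eval.
Qed.

(** If a composite is chordless, so are its factors, and their colours match. By induction both
    parts are congruent to corollas, which the generating relation then merges. *)
Lemma chordless_eval t : wf_tree t -> 2 <= arity t -> chordless (eval t) ->
  env_cong t (corolla (eval t)).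
Proof.
have [n] := ubnP (arity t); elim: n t => // n IH t /ltnSE Hn Ht H2 Ch.
case: (tree_cases Ht) => [Et|[x Hx Et]|[t1 [k [t2 [Et W1 W2 Hk [L1 L2]]]]]].
- by rewrite Et in H2.
- by rewrite {2}Et eval_corolla // -Et; exact: ec_refl.
have [B1 B2] := (eval_is_bnc W1, eval_is_bnc W2).
have [S1 S2] := (bsize_eval W1, bsize_eval W2).
move: Ch Hn; rewrite Et arity_graft // eval_graft //.
case/chordless_comp; rewrite ?S1 ?S2 // => C1 C2 E Hn.
have E1 : env_cong t1 (corolla (eval t1)) by apply: IH => //; lia.
have E2 : env_cong t2 (corolla (eval t2)) by apply: IH => //; lia.
apply: ec_trans (env_cong_graft E1 E2 Hk) _.
by apply: ec_base => //; rewrite ?S1 //; split=> //; rewrite ?S1 ?S2.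
Qed.

Lemma chordlessP c : chordless c \/
  exists i m, is_diagonal (bsize c) i (i + m) /\ col c i (i + m) <> Unc.
Proof.
set n := bsize c.
(* A boolean form of being a coloured diagonal, so that a search over finitely many pairs decides
   whether one exists. *)
pose P (p : 'I_n.+2 * 'I_n.+2) := [&& 1 <= p.1, p.1 < p.2, p.2 != p.1.+1 :> nat,
  ~~ ((p.1 == 1 :> nat) && (p.2 == n.+1 :> nat))
  & if col c p.1 p.2 is Unc then false else true].
case: (boolP [exists p, P p]) => [/existsP[[i j]]|/existsPn N].
  case/and5P => /= H1 H2 H3 H4 H5; right; exists i, (j - i).
  rewrite subnKC; last lia.
  split; last by move: H5; case: (col c i j).
  by have := ltn_ord j; rewrite /is_diagonal /is_arc; lia.
left=> i j; rewrite -/n => -[[A1 [A2 A3]] [N1 N2]].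
have Li : i < n.+2 by lia.
have Lj : j < n.+2 by lia.
have := N (Ordinal Li, Ordinal Lj); rewrite /P /= A1 A2 /=.
rewrite (_ : j != i.+1) /=; last lia.
rewrite (_ : ~~ ((i == 1) && (j == n.+1))) /=; last lia.
by case: (col c i j).
Qed.

Lemma arity1_Leaf t : wf_tree t -> arity t = 1 -> t = Leaf.
Proof.
case: t => // x ts [[_ x2 _] Es] /(proj2 arity_bounds).
by rewrite arity_Node; lia.
Qed.

Lemma env_cong_complete t t' :
  wf_tree t -> wf_tree t' -> eval t = eval t' -> env_cong t t'.
Proof.
have [n] := ubnP (arity t); elim: n t t' => // n IH t t' /ltnSE Hn W W' E.
have Ea : arity t = arity t' by rewrite -!bsize_eval // E.
have A := arity_gt0 W.
case: (chordlessP (eval t)) => [Ch|[i [m []]]].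
  have [A1|A2] : arity t = 1 \/ 2 <= arity t by lia.
    by rewrite (arity1_Leaf W A1) (arity1_Leaf W') -?Ea //; exact: ec_refl.
  apply: ec_trans (chordless_eval W A2 Ch) _; apply: ec_sym; rewrite E.
  by apply: chordless_eval; rewrite -?Ea -?E.
rewrite bsize_eval // => Hd Hc.
(* One coloured diagonal of the common value splits both trees at the same position, with upper
   parts of the same arity [m]. *)
case: (eval_chord W Hd Hc) => t1 [t2 [Et W1 W2 Hi Hm]].
rewrite E in Hc; rewrite Ea in Hd.
case: (eval_chord W' Hd Hc) => t1' [t2' [Et' W1' W2' Hi' Hm']].
rewrite -E -Ea in Hc Hd.
have Em : m = arity t2 by lia.
have Em' : m = arity t2' by lia.
have [B1 B2] := (eval_is_bnc W1, eval_is_bnc W2).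
have [B1' B2'] := (eval_is_bnc W1', eval_is_bnc W2').
have Es : eval t = bnc_comp (eval t1) i (eval t2) by rewrite Et eval_graft.
have Es' : eval t = bnc_comp (eval t1') i (eval t2') by rewrite E Et' eval_graft.
rewrite -bsize_eval // in Hd.
(* The values of the parts of either tree are the two pieces of the common value, hence agree
   pairwise; the parts being smaller, induction applies. *)
have [] := parts_comp B1 B2 (i := i); rewrite ?bsize_eval -?Em -?Es // => P1 P2.
have [] := parts_comp B1' B2' (i := i); rewrite ?bsize_eval -?Em' -?Es' // => P1' P2'.
have Aa : arity t = (arity t1 + arity t2).-1 by rewrite Et arity_graft.
move: Hd; rewrite bsize_eval // => -[[D1 [D2 D3]] [D4 D5]].
rewrite Et Et'; apply: env_cong_graft => //; apply: IH => //; try lia.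
  by rewrite -P1.
by rewrite -P2.
Qed.

Lemma eval_surj c : is_bnc c -> exists2 t, wf_tree t & eval t = c.
Proof.
have [n] := ubnP (bsize c); elim: n c => // n IH c /ltnSE Hn Hc.
have c1 := bnc_size_gt0 Hc.
case: (chordlessP c) => [Ch|[i [m [Hd Hcol]]]].
  have [E|c2] : bsize c = 1 \/ 2 <= bsize c by lia.
    by exists Leaf => //; rewrite (bnc_size1 Hc E).
  have Hb : is_bubble c by [].
  by exists (corolla c); [exact: wf_corolla | exact: eval_corolla].
have [[D1 [D2 D3]] [D4 D5]] := Hd.
(* Cutting along a diagonal makes both pieces strictly smaller than [c]. *)
have [|t1 W1 E1] := IH _ _ (base_part_is_bnc Hc Hd); first by rewrite /=; lia.
have [|t2 W2 E2] := IH _ _ (top_part_is_bnc Hc Hd); first by rewrite /=; lia.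
exists (graft t1 i t2); first exact: wf_graft.
rewrite eval_graft // ?E1 ?E2 ?comp_parts //.
by rewrite -bsize_eval // E1 /=; lia.
Qed.

Theorem theorem2p8 : exists phi : tree -> bnc, env_iso phi.
Proof.
exists eval; split.
- by move=> t Ht; rewrite bsize_eval //; split=> //; exact: eval_is_bnc.
- by split=> // t i s; exact: eval_graft.
- by move=> t t' /env_cong_sound[].
- exact: env_cong_complete.
- exact: eval_surj.
Qed.
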